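(* Let $\varphi$ be a bidimensional square morphism of size $2$ over the alphabet $\{0,1\}$ that is prolongable on $1$, and let $\varphi^\omega(1)$ be its fixed point beginning with $1$. Then $\varphi^\omega(1)$ is strongly uniformly recurrent along all directions (SURD) if and only if either $\varphi(0)_{(0,0)}=1$ or $\varphi(1)_{(i,j)}=1$ for all $(i,j)\in\{0,1\}^2$.
   Context: $\mathbb{N}=\{0,1,\ldots\}$. A bidimensional infinite word over $A$ is a map $w\colon\mathbb{N}^2\to A$. A bidimensional square morphism of size $s$ is a map $\varphi$ sending each letter $a\in A$ to a block $\varphi(a)\colon\{0,\ldots,s-1\}^2\to A$; we write $\varphi(a)_{\mathbf{i}}$ for $\varphi(a)(\mathbf{i})$. Its iterates are $\varphi^n(a)\colon\{0,\ldots,s^n-1\}^2\to A$, $\varphi^n(a)(\mathbf{i})=\varphi\big(\varphi^{n-1}(a)(\mathbf{q})\big)(\mathbf{r})$, where $\mathbf{i}=s\mathbf{q}+\mathbf{r}$ is componentwise Euclidean division ($\mathbf{r}\in\{0,\ldots,s-1\}^2$). $\varphi$ is prolongable on $a$ if $\varphi(a)_{(0,0)}=a$; then $\varphi^n(a)$ is a prefix of $\varphi^{n+1}(a)$ and the limit word $\varphi^\omega(a)\colon\mathbb{N}^2\to A$ is the fixed point beginning with $a$. For a bidimensional word $w$, a size $\mathbf{s}=(s_1,s_2)$ and a direction $\mathbf{q}\in\mathbb{N}^2$ (coprime nonnegative entries), $w_{\mathbf{q},\mathbf{s}}$ is the one-dimensional word whose $\ell$-th letter is the block $\mathbf{i}\mapsto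 w(\mathbf{i}+\ell\mathbf{q})$, $\mathbf{i}\in\{0,\ldots,s_1-1\}\times\{0,\ldots,s_2-1\}$. $w$ is SURD if for each $\mathbf{s}$ there is $b\in\mathbb{N}$ such that for every direction $\mathbf{q}$, every length-$b$ factor of $w_{\mathbf{q},\mathbf{s}}$ contains the letter $w_{\mathbf{q},\mathbf{s}}(0)$. *)

(* Defs.v *)
From HB Require Import structures.
From mathcomp Require Import all_boot all_order all_algebra.

Set Implicit Arguments.
Unset Strict Implicit.
Unset Printing Implicit Defensive.

Definition block (A : Type) (m n : nat) := {ffun 'I_m * 'I_n -> A}.

Definition word2 (A : Type) := nat * nat -> A.

Definition square_morphism (A : Type) (s : nat) := A -> block A s s.

Lemma ord_quot_subproof (s n : nat) (i : 'I_(s ^ n.+1)) : i %/ s < s ^ n.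
Proof.
case: s i => [[i]|s i]; first by rewrite exp0n.
by rewrite ltn_divLR // -expnSr.
Qed.

Lemma ord_rem_subproof (s n : nat) (i : 'I_(s ^ n.+1)) : i %% s < s.
Proof. by case: s i => [[i]|s i]; [rewrite exp0n | rewrite ltn_mod]. Qed.

Definition ord_quot (s n : nat) (i : 'I_(s ^ n.+1)) : 'I_(s ^ n) :=
  Ordinal (ord_quot_subproof i).

Definition ord_rem (s n : nat) (i : 'I_(s ^ n.+1)) : 'I_s :=
  Ordinal (ord_rem_subproof i).

Fixpoint iter_morphism (A : Type) (s : nat) (phi : square_morphism A s)
    (n : nat) (a : A) : block A (s ^ n) (s ^ n) :=
  match n with
  | 0 => [ffun=> a]
  | n'.+1 => [ffun i =>
      phi (iter_morphism phi n' a (ord_quot i.1, ord_quot i.2))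
          (ord_rem i.1, ord_rem i.2)]
  end.

Definition prolongable (A : Type) (s : nat) (phi : square_morphism A s)
    (a : A) : Prop :=
  forall i : 'I_s * 'I_s, i.1 = 0 :> nat -> i.2 = 0 :> nat -> phi a i = a.

Lemma ltn_expn_maxl (s i j : nat) : 1 < s -> i < s ^ maxn i j.
Proof.
move=> s_gt1; apply: leq_trans (ltn_expl i s_gt1) _.
by rewrite leq_exp2l // leq_maxl.
Qed.

Lemma ltn_expn_maxr (s i j : nat) : 1 < s -> j < s ^ maxn i j.
Proof. by rewrite maxnC; apply: ltn_expn_maxl. Qed.

(* The letter at i is read in the iterate of order max(i.1, i.2), whose domain
   contains i since s >= 2. When phi is prolongable on a, every iterate
   containing i gives the same letter: see limit_wordP. *)
Definition limit_word (A : Type) (s : nat) (s_gt1 : 1 < s)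
    (phi : square_morphism A s) (a : A) : word2 A :=
  fun i => iter_morphism phi (maxn i.1 i.2) a
    (Ordinal (ltn_expn_maxl i.1 i.2 s_gt1),
     Ordinal (ltn_expn_maxr i.1 i.2 s_gt1)).

Lemma iter_morphism_prefix (A : Type) (s : nat) (phi : square_morphism A s)
    (a : A) : prolongable phi a ->
  forall (n m : nat) (i : 'I_(s ^ n) * 'I_(s ^ n)) (j : 'I_(s ^ m) * 'I_(s ^ m)),
  i.1 = j.1 :> nat -> i.2 = j.2 :> nat ->
  iter_morphism phi n a i = iter_morphism phi m a j.
Proof.
move=> phia.
have zero m (j : 'I_(s ^ m) * 'I_(s ^ m)) :
    j.1 = 0 :> nat -> j.2 = 0 :> nat -> iter_morphism phi m a j = a.
  elim: m j => [|m IHm] j j1 j2 /=; first by rewrite ffunE.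
  rewrite ffunE IHm /= ?j1 ?j2 ?div0n //.
  by apply: phia; rewrite /= ?j1 ?j2 mod0n.
elim=> [|n IHn] [|m] i j ij1 ij2.
- by rewrite !ffunE.
- have i0 (k : 'I_(s ^ 0)) : k = 0 :> nat by case: k => [[|k]].
  by rewrite [RHS]zero -?ij1 -?ij2 ?i0 //= ffunE.
- have i0 (k : 'I_(s ^ 0)) : k = 0 :> nat by case: k => [[|k]].
  by rewrite [LHS]zero ?ij1 ?ij2 ?i0 //= ffunE.
- rewrite /= !ffunE (IHn m _ (ord_quot j.1, ord_quot j.2)) /= ?ij1 ?ij2 //.
  by congr (phi _ (_, _)); apply: val_inj; rewrite /= ?ij1 ?ij2.
Qed.

Lemma limit_wordP (A : Type) (s : nat) (s_gt1 : 1 < s)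
    (phi : square_morphism A s) (a : A) : prolongable phi a ->
  forall (n : nat) (i : 'I_(s ^ n) * 'I_(s ^ n)),
  limit_word s_gt1 phi a (val i.1, val i.2) = iter_morphism phi n a i.
Proof. by move=> phia n i; apply: iter_morphism_prefix. Qed.

Definition directional_word (A : Type) (w : word2 A) (q s : nat * nat) :
    nat -> block A s.1 s.2 :=
  fun l => [ffun i : 'I_s.1 * 'I_s.2 => w (i.1 + l * q.1, i.2 + l * q.2)].

Definition factor (T : Type) (u : nat -> T) (n b : nat) : seq T :=
  mkseq (fun k => u (n + k)) b.

Definition SURD (A : eqType) (w : word2 A) : Prop :=
  forall s : nat * nat, exists b : nat,
  forall q : nat * nat, coprime q.1 q.2 ->
  forall n : nat,
  directional_word w q s 0 \in
    (factor (directional_word w q s) n b : seq {ffun 'I_s.1 * 'I_s.2 -> A}).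

(* Main.v *)
Require Import Defs.
From HB Require Import structures.
From mathcomp Require Import all_boot all_order all_algebra zify.
Local Open Scope ring_scope.

(** If every image [phi c] has the letter [1] in its corner, then
    [w (2^(n+1) p + r) = w r] whenever both entries of [r] are below [2^n], so
    prefixes of [w] recur with bounded gaps along every direction. If [phi 1] is
    constant, so is [w].

    Otherwise the corner map [f 0 0 : c |-> phi c (0, 0)] is the identity, and
    some [f c1 c2] sends [1] to [0]; up to exchanging the coordinates it is
    [f 1 c]. The letter of [w] at a position is obtained by composing the maps
    [f] along the binary digits of the position. For [1 <= k <= 2^n] the digit sum
    of [k (2^n - 1)] is exactly [n], so, for [n] odd, along the direction
    [(2^n - 1, c (2^n - 1) + 4^n (2^(n+1) - 1))] the positions
    [k = 1, ..., 2^n] apply [f 0 1] an even number of times and then [f 1 c] an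
    odd number of times. The exchange is chosen so that [f 1 c] is constant or
    [f 0 1] is not constantly [0]; the result is then [0] on the whole range, and
    [w] has arbitrarily long runs of [0] along coprime directions. *)

Set Implicit Arguments.
Unset Strict Implicit.
Unset Printing Implicit Defensive.

(** * Fixed-point equation and sufficiency of the two conditions *)

Section LimitWord.
Local Open Scope nat_scope.
Variables (A : eqType) (s : nat) (s_gt1 : 1 < s).
Variables (phi : square_morphism A s) (a : A).

Let w := limit_word s_gt1 phi a.

Lemma limit_word_fixed : prolongable phi a ->
  forall (x y : nat) (i j : 'I_s), w (x * s + i, y * s + j) = phi (w (x, y)) (i, j).
Proof.
move=> phia x y i j; pose m := maxn x y.
have s_gt0 : 0 < s by exact: ltnW.
have bound (z : nat) (k : 'I_s) : z < s ^ m -> z * s + k < s ^ m.+1.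
  move=> zm; rewrite expnSr; apply: leq_trans (_ : z.+1 * s <= _).
    by rewrite mulSn addnC ltn_add2r.
  by rewrite leq_mul2r zm orbT.
pose X := Ordinal (bound _ i (ltn_expn_maxl x y s_gt1)).
pose Y := Ordinal (bound _ j (ltn_expn_maxr x y s_gt1)).
have -> : w (x * s + i, y * s + j) = iter_morphism phi m.+1 a (X, Y).
  exact: (limit_wordP s_gt1 phia (X, Y)).
rewrite /= ffunE; congr (phi _ (_, _)).
- apply: iter_morphism_prefix => //=;
    by rewrite divnMDl // divn_small ?addn0.
- by apply: val_inj; rewrite /= modnMDl modn_small.
- by apply: val_inj; rewrite /= modnMDl modn_small.
Qed.

Lemma limit_word_const :
  (forall i, phi a i = a) -> forall p, w p = a.
Proof.
move=> phia p; rewrite /w /limit_word.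
have iter_const n i : iter_morphism phi n a i = a.
  by elim: n i => [|n IHn] i; rewrite /= ffunE // IHn phia.
exact: iter_const.
Qed.

(** A common corner makes [w] equal to [a] at all multiples of [s], whatever the parent letter;
    removing one base-[s] digit at a time reduces to this. The exponent [n.+1] leaves the extra
    digit at which the parent is forgotten. *)
Lemma limit_word_periodic_prefix :
    (forall c (i : 'I_s * 'I_s), i.1 = 0 :> nat -> i.2 = 0 :> nat -> phi c i = a) ->
  forall n x y i j, i < s ^ n -> j < s ^ n ->
  w (x * s ^ n.+1 + i, y * s ^ n.+1 + j) = w (i, j).
Proof.
move=> phi0; have phia : prolongable phi a by exact: phi0.
have s_gt0 : 0 < s by exact: ltnW.
pose o := Ordinal s_gt0.
have w_mul x y : w (x * s, y * s) = a.
  have := limit_word_fixed phia x y o o.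
  by rewrite /= !addn0 => ->; exact: phi0.
elim=> [|n IHn] x y i j.
  rewrite !ltnS !leqn0 => /eqP -> /eqP ->; rewrite !addn0 expn1 w_mul.
  by rewrite -(w_mul 0 0) !mul0n.
move=> ltis ltjs.
pose ri := Ordinal (ltn_pmod i s_gt0); pose rj := Ordinal (ltn_pmod j s_gt0).
have split z k : z * s ^ n.+2 + k = (z * s ^ n.+1 + k %/ s) * s + k %% s.
  by rewrite mulnDl -mulnA -expnSr -addnA -divn_eq.
rewrite !split (limit_word_fixed phia _ _ ri rj) IHn ?ltn_divLR -?expnSr //.
by rewrite -(limit_word_fixed phia _ _ ri rj) -!divn_eq.
Qed.

Lemma SURD_const : (forall i, phi a i = a) -> SURD w.
Proof.
move=> phia u; exists 1 => q _ n; rewrite inE; apply/eqP/ffunP => i.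
by rewrite !ffunE !limit_word_const.
Qed.

Lemma SURD_common_corner :
  (forall c (i : 'I_s * 'I_s), i.1 = 0 :> nat -> i.2 = 0 :> nat -> phi c i = a) -> SURD w.
Proof.
move=> phi0 u; pose n := maxn u.1 u.2; pose b := s ^ n.+1.
exists b.+1 => q _ m.
have b_gt0 : 0 < b by rewrite expn_gt0 (ltnW s_gt1).
(* The first multiple of [b] beyond [m] lies in the window; there both coordinates are shifted by
   multiples of [s ^ n.+1], whatever [q]. *)
have lt_m : m < (m %/ b).+1 * b by rewrite -ltn_divLR // ltnS.
have le_m : (m %/ b).+1 * b <= m + b by rewrite mulSn addnC leq_add2r leq_trunc_div.
apply/mapP; exists ((m %/ b).+1 * b - m); first by rewrite mem_iota; lia.
rewrite subnKC ?(ltnW lt_m) //; apply/ffunP => i; rewrite !ffunE !mul0n !addn0.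
rewrite ![_ * b * _]mulnAC ![_ + _ * b]addnC limit_word_periodic_prefix //.
  by apply: ltn_trans (ltn_ord i.1) (ltn_expn_maxl _ _ s_gt1).
by apply: ltn_trans (ltn_ord i.2) (ltn_expn_maxr _ _ s_gt1).
Qed.

End LimitWord.

(** * Binary digit sums of multiples of [2 ^ n - 1] *)

Section DigitSum.
Local Open Scope nat_scope.

Fixpoint digit_sum (n j : nat) : nat :=
  if n is n'.+1 then odd j + digit_sum n' j./2 else 0.

Lemma digit_sum_cat m n i j : i < 2 ^ n ->
  digit_sum (n + m) (j * 2 ^ n + i) = digit_sum n i + digit_sum m j.
Proof.
elim: n i => [|n IHn] i.
  by rewrite ltnS leqn0 => /eqP ->; rewrite muln1 addn0.
rewrite expnS => lti; rewrite addSn /=.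
have -> : j * (2 * 2 ^ n) + i = i + (j * 2 ^ n).*2 by lia.
rewrite oddD odd_double addbF halfD odd_double andbF add0n doubleK.
by rewrite addnC [_./2 + _]addnC IHn; lia.
Qed.

(** On [n] digits, [2 ^ n - j.+1] is the bitwise complement of [j], so each position contributes
    exactly one. *)
Lemma digit_sum_compl n j : j < 2 ^ n ->
  digit_sum n j + digit_sum n (2 ^ n - j.+1) = n.
Proof.
elim: n j => [|n IHn] j; first by [].
rewrite expnS => ltj /=.
have -> : (2 * 2 ^ n - j.+1)./2 = 2 ^ n - (j./2).+1 by lia.
have -> : odd (2 * 2 ^ n - j.+1) = ~~ odd j by lia.
have /IHn : j./2 < 2 ^ n by lia.
by case: (odd j) => /=; lia.
Qed.

(* [k (2^n - 1) = (k - 1) 2^n + (2^n - k)]: the two halves are complementary. *)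
Lemma digit_sum_mul n k : 0 < k <= 2 ^ n ->
  digit_sum (n + n) (k * (2 ^ n).-1) = n.
Proof.
case: k => [//|k] /= ltk.
have -> : k.+1 * (2 ^ n).-1 = k * 2 ^ n + (2 ^ n - k.+1) by nia.
by rewrite digit_sum_cat; [have := digit_sum_compl ltk; lia | lia].
Qed.

Lemma ltn_mul_pred_exp2 n k : k <= 2 ^ n -> k * (2 ^ n).-1 < 2 ^ (n + n).
Proof.
have n_gt0 : 0 < 2 ^ n by rewrite expn_gt0.
by rewrite expnD; nia.
Qed.

Lemma coprime_pred_exp2 n : coprime (2 ^ n).-1 (2 ^ n.+1).-1.
Proof.
have n_gt0 : 0 < 2 ^ n by rewrite expn_gt0.
have -> : (2 ^ n.+1).-1 = 2 * (2 ^ n).-1 + 1 by rewrite expnS; lia.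
by rewrite /coprime gcdnMDl gcdn1.
Qed.

Lemma coprime_pred_exp2_exp2 n m : 0 < n -> coprime (2 ^ n).-1 (2 ^ m).
Proof.
move=> n_gt0; apply: coprimeXr; rewrite coprimen2.
by case: n n_gt0 => // n _; have := expn_gt0 2 n; rewrite expnS; lia.
Qed.

End DigitSum.

(** * Parity of iterates of maps on two letters *)

Section BoolIterates.
Local Open Scope nat_scope.
Implicit Types h g : bool -> bool.

(** Either [h] fixes [true], or it sends [true] to [false] and back; in both cases its square fixes
    [true]. *)
Lemma iter_even_true h n : h true || h false -> iter n.*2 h true = true.
Proof.
move=> hh; elim: n => // n IHn; rewrite doubleS !iterS IHn.
by case ht: (h true); [rewrite ht | move: hh; rewrite ht].
Qed.

Lemma iter_odd_true g n : g true = false -> iter n.*2.+1 g true = false.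
Proof.
move=> gt; elim: n => // n IHn; rewrite doubleS iterS iterS IHn.
by case gf: (g false).
Qed.

Lemma iter_succ_const_false g n b : g true = false -> g false = false ->
  iter n.+1 g b = false.
Proof. by move=> gt gf; rewrite iterS; case: (iter n g b). Qed.

End BoolIterates.

(** * Directions with long runs of zeros *)

Section LongRuns.
Local Open Scope nat_scope.
Variables (v : nat -> nat -> bool) (f : bool -> bool -> bool -> bool).
Hypothesis v_fixed :
  forall x y (i j : bool), v (x * 2 + i) (y * 2 + j) = f i j (v x y).
Hypothesis v00 : v 0 0.
Hypothesis f00 : f false false =1 id.

(** Zero digits of [j] act by [f false false], the identity, and each digit one applies
    [f c1 c2]. *)
Lemma word_digits (c1 c2 : bool) n j x y : j < 2 ^ n ->
  v (x * 2 ^ n + c1 * j) (y * 2 ^ n + c2 * j)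
    = iter (digit_sum n j) (f c1 c2) (v x y).
Proof.
elim: n j x y => [|n IHn] j x y.
  by rewrite ltnS leqn0 => /eqP ->; rewrite !muln1 !muln0 !addn0.
rewrite expnS => ltj.
have split (c : bool) z :
    z * (2 * 2 ^ n) + c * j = (z * 2 ^ n + c * j./2) * 2 + (c && odd j : bool).
  by case: c; case oj: (odd j); have := odd_double_half j; rewrite oj /=; lia.
rewrite !split v_fixed IHn; last by lia.
by rewrite /=; case: (odd j); rewrite ?andbT ?andbF ?f00 // add1n iterS.
Qed.

Lemma long_zero_runs (c : bool) (b : nat) :
    f true c true = false ->
    ~~ f true c false || (f false true true || f false true false) ->
  exists2 q : nat * nat, coprime q.1 q.2 &
    forall k, k < b -> v (k.+1 * q.1) (k.+1 * q.2) = false.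
Proof.
move=> gt ghP; pose n := b.*2.+1; pose x := (2 ^ n).-1; pose z := (2 ^ n.+1).-1.
(* The factor [2 ^ (n + n)] places [k.+1 * z] above all digits of [k.+1 * x], so its [n.+1] ones act
   first, by [f false true]. *)
exists (x, c * x + z * 2 ^ (n + n)).
  rewrite /= /coprime gcdnMDl -/(coprime _ _) coprimeMr.
  by rewrite coprime_pred_exp2 coprime_pred_exp2_exp2.
move=> k ltkb /=.
have lek : k < 2 ^ n by have := ltn_expl n (isT : 1 < 2); lia.
have lek' : k < 2 ^ n.+1 by rewrite expnS; lia.
have := word_digits true c 0 (k.+1 * z) (ltn_mul_pred_exp2 lek).
have := word_digits false true 0 0 (ltn_mul_pred_exp2 lek').
rewrite !digit_sum_mul ?lek ?lek' // !mul0n !add0n !mul1n v00.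
rewrite -/x -/z => vz.
have -> : k.+1 * (c * x + z * 2 ^ (n + n)) = k.+1 * z * 2 ^ (n + n) + c * (k.+1 * x).
  by rewrite mulnDr addnC mulnA; congr (_ + _); rewrite mulnCA.
rewrite vz => ->.
(* If [f true c] is constantly [false], the letter it starts from is irrelevant; otherwise [ghP]
   ensures that this letter is [true]. *)
have [gf|gf] := boolP (f true c false); last first.
  by apply: (@iter_succ_const_false _ b.*2); rewrite // (negbTE gf).
by rewrite gf /= in ghP; rewrite -doubleS iter_even_true // iter_odd_true.
Qed.

End LongRuns.

(** If [f false true] is constantly [false], exchanging the coordinates makes this constant map act
    last. Otherwise [long_zero_runs] applies directly when [f true false] or [f true true] sends
    [true] to [false], and after the exchange when only [f false true] does, since [f true false]
    then keeps [true]. *)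
Lemma long_zero_runs_sym (v : nat -> nat -> bool)
    (f : bool -> bool -> bool -> bool) (b : nat) :
  (forall x y (i j : bool),
     v (x * 2 + i)%N (y * 2 + j)%N = f i j (v x y)) ->
  v 0%N 0%N -> f false false =1 id ->
  ~~ [&& f false true true, f true false true & f true true true] ->
  exists2 q : nat * nat, coprime q.1 q.2 &
    forall k, (k < b)%N -> v (k.+1 * q.1)%N (k.+1 * q.2)%N = false.
Proof.
move=> vf v00 f00 f1.
have swap : f false true true = false ->
    ~~ f false true false || (f true false true || f true false false) ->
    exists2 q : nat * nat, coprime q.1 q.2 &
      forall k, (k < b)%N -> v (k.+1 * q.1)%N (k.+1 * q.2)%N = false.
  move=> gt ghP.
  have [|q cq vq] := @long_zero_runs (fun x y => v y x) (fun i j => f j i)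
    _ v00 f00 false b gt ghP; first by move=> x y i j; exact: vf.
  by exists (q.2, q.1); rewrite // coprime_sym.
have runs := long_zero_runs vf v00 f00.
case h1: (f false true true); case h0: (f false true false);
  case e1: (f true false true); case d1: (f true true true);
  move: f1; rewrite ?h1 ?e1 ?d1 // => _;
  first [ by apply: (runs false); rewrite ?e1 ?h1 ?h0 ?orbT
        | by apply: (runs true); rewrite ?d1 ?h1 ?h0 ?orbT
        | by apply: swap; rewrite ?h1 ?h0 ?e1 ?orbT ].
Qed.

(** * Necessity of the conditions *)

Section Necessity.
Variable phi : square_morphism 'I_2 2.
Hypothesis phi1 : prolongable phi 1.

Let w := limit_word (isT : (1 < 2)%N) phi 1.
Let ord_of_bool (b : bool) : 'I_2 := if b then 1 else 0.

Lemma ord_of_bool_eq1 (c : 'I_2) : ord_of_bool (c == 1) = c.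
Proof. by case: c => [[|[|c]] ltc] //; apply: val_inj. Qed.

Lemma not_SURD_binary (i j : 'I_2) :
  phi 0 (0, 0) <> 1 -> phi 1 (i, j) <> 1 -> ~ SURD w.
Proof.
move=> phi0 phi1ij surd.
(* Blocks of size [(1, 1)] are single letters. *)
have [b wb] := surd (1%N, 1%N).
pose v x y := w (x, y) == 1.
pose f (k l c : bool) :=
  phi (ord_of_bool c) (ord_of_bool k, ord_of_bool l) == 1.
have vf x y (k l : bool) : v (x * 2 + k)%N (y * 2 + l)%N = f k l (v x y).
  rewrite /f /v ord_of_bool_eq1 -(limit_word_fixed _ phi1).
  by case: k; case: l.
have w00 : w (0%N, 0%N) = 1 by rewrite /w /limit_word ffunE.
have f00 : f false false =1 id.
  by case; rewrite /f /=; [rewrite phi1 | apply/eqP].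
have f1 : ~~ [&& f false true true, f true false true & f true true true].
  apply/negP => /and3P[/eqP h1 /eqP e1 /eqP d1]; apply: phi1ij.
  rewrite -(ord_of_bool_eq1 i) -(ord_of_bool_eq1 j).
  by case: (i == 1); case: (j == 1) => //=; exact: phi1.
have v00 : v 0%N 0%N by rewrite /v w00.
have [q cq vq] := long_zero_runs_sym b vf v00 f00 f1.
(* The window starts at 1, just after the origin, whose letter is 1. *)
have /mapP[k] := wb q cq 1%N.
rewrite mem_iota add0n => /= ltkb /ffunP/(_ (ord0, ord0)).
rewrite !ffunE !mul0n !add0n add1n /= w00 => wk.
by have := vq k ltkb; rewrite /v -wk eqxx.
Qed.

End Necessity.

Theorem theorem6p20 (phi : square_morphism 'I_2 2) (hphi : prolongable phi 1) :
  SURD (limit_word (isT : (1 < 2)%N) phi 1) <->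
  (phi 0 (0, 0) = 1 \/ forall i j : 'I_2, phi 1 (i, j) = 1).
Proof.
split=> [surd|[phi0|phi1]].
- have [phi0|phi0] := eqVneq (phi 0 (0, 0)) 1; [by left | right => i j].
  apply/eqP/negPn/negP => /eqP phi1ij.
  by apply: not_SURD_binary surd => //; [apply/eqP | exact: phi1ij].
- apply: SURD_common_corner => c [i j] /= i0 j0.
  have -> : i = 0 by apply: val_inj.
  have -> : j = 0 by apply: val_inj.
  case: c => [[|[|c]] ltc] //.
    by rewrite -[RHS]phi0; congr (phi _ _); apply: val_inj.
  have -> : Ordinal ltc = 1 by apply: val_inj.
  exact: hphi.
- by apply: SURD_const => -[i j].
Qed.
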